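(* Let $T_n^1$ and $T_n^2$ be two independent uniform attachment trees with $n$ vertices each, and let $X_n$ be the number of vertices of their largest common (unlabeled) subtree. Then $$\lim_{n\to\infty}\mathbb{P}\left(X_n \leq 0.999\, n\right) = 1 .$$
   Context: A uniform attachment tree (random recursive tree) is defined recursively: $T_1$ is a single vertex, and given $T_n$, the tree $T_{n+1}$ is obtained by adding one new vertex and joining it by a single edge to a vertex of $T_n$ chosen uniformly at random, independently of everything else. For two finite trees $T^1,T^2$ (viewed as unlabeled, unrooted graphs), the size of their largest common subtree is the maximum of $|S|$ (number of vertices of $S$) over all trees $S$ such that $S$ is isomorphic to a subtree (connected subgraph) of $T^1$ and to a subtree of $T^2$; $X_n$ is this quantity for $T_n^1$ and $T_n^2$. *)

(* Defs.v *)
From mathcomp Require Import all_boot all_order all_algebra.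
From mathcomp Require Import all_classical all_reals all_analysis.

Set Implicit Arguments.
Unset Strict Implicit.
Unset Printing Implicit Defensive.

Import Order.TTheory GRing.Theory Num.Theory.
Local Open Scope classical_set_scope.
Local Open Scope ring_scope.

(** * Finite simple graphs, trees and subtrees *)

Record sgraph (V : finType) := SGraph {
  adj :> rel V;
  adj_sym : symmetric adj;
  adj_irrefl : irreflexive adj }.

Definition connected_graph (V : finType) (G : sgraph V) : Prop :=
  forall x y : V, connect G x y.

(* In a simple graph a duplicate-free cyclic sequence of length at most 2 is
   not a cycle: [:: x; y] only walks back and forth along an edge. *)
Definition acyclic_graph (V : finType) (G : sgraph V) : Prop :=
  forall c : seq V, (2 < size c)%N -> ~~ ucycleb G c.

Definition is_tree (V : finType) (G : sgraph V) : Prop :=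
  [/\ (0 < #|V|)%N, connected_graph G & acyclic_graph G].

Definition isomorphic (V W : finType) (G : sgraph V) (H : sgraph W) : Prop :=
  exists2 f : V -> W, bijective f & {mono f : x y / G x y >-> H x y}.

Record subgraph (V : finType) (G : sgraph V) := Subgraph {
  sub_verts : {set V};
  sub_adj : rel V;
  sub_adj_sym : symmetric sub_adj;
  sub_adjP : forall x y, sub_adj x y ->
    [/\ G x y, x \in sub_verts & y \in sub_verts] }.

Section SubgraphGraph.
Variables (V : finType) (G : sgraph V) (K : subgraph G).

Let K_adj : rel {x : V | x \in sub_verts K} :=
  fun x y => sub_adj K (val x) (val y).

Fact subgraph_sym : symmetric K_adj.
Proof. by move=> x y; exact: sub_adj_sym. Qed.

Fact subgraph_irrefl : irreflexive K_adj.
Proof.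
by move=> x; apply/negP => /sub_adjP[]; rewrite adj_irrefl.
Qed.

Definition graph_of_subgraph : sgraph {x : V | x \in sub_verts K} :=
  SGraph subgraph_sym subgraph_irrefl.

End SubgraphGraph.

Definition isomorphic_to_subtree (W V : finType) (S : sgraph W) (G : sgraph V) :
    Prop :=
  exists2 K : subgraph G, connected_graph (graph_of_subgraph K) &
    isomorphic S (graph_of_subgraph K).

Definition common_subtree (W V1 V2 : finType)
    (S : sgraph W) (G1 : sgraph V1) (G2 : sgraph V2) : Prop :=
  [/\ is_tree S, isomorphic_to_subtree S G1 & isomorphic_to_subtree S G2].

(* The bound on k loses nothing: a graph isomorphic to a subgraph of G1 has at
   most #|V1| vertices. *)
Definition largest_common_subtree_size (V1 V2 : finType)
    (G1 : sgraph V1) (G2 : sgraph V2) : nat :=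
  \max_(k < #|V1|.+1 | `[< exists (W : finType) (S : sgraph W),
                             #|W| = k /\ common_subtree S G1 G2 >]) k.

(** * Uniform attachment trees *)

Definition edgeless_graph (V : finType) : sgraph V :=
  @SGraph V (fun _ _ => false) (fun _ _ => erefl) (fun _ => erefl).

Section Attach.
Variables (n : nat) (G : sgraph 'I_n) (v : 'I_n).

(* The old vertices are the [lift ord_max i], with the same value as i; the
   new vertex is [ord_max], for which [unlift] returns [None]. *)
Definition attach_adj : rel 'I_n.+1 := fun x y =>
  match unlift ord_max x, unlift ord_max y with
  | Some i, Some j => G i j
  | Some i, None => i == v
  | None, Some j => j == v
  | None, None => false
  end.

Fact attach_sym : symmetric attach_adj.
Proof.
move=> x y; rewrite /attach_adj.
by case: (unlift _ x) => [i|]; case: (unlift _ y) => [j|] //; exact: adj_sym.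
Qed.

Fact attach_irrefl : irreflexive attach_adj.
Proof.
by move=> x; rewrite /attach_adj; case: (unlift _ x) => [i|] //; exact: adj_irrefl.
Qed.

Definition attach : sgraph 'I_n.+1 := SGraph attach_sym attach_irrefl.

End Attach.

Section Random.
Context (d : measure_display) (Omega : measurableType d) (R : realType).
Variable P : probability Omega R.

(* For random elements X and Y with finitely many values, so that arbitrary
   sets of values are allowed. *)
Definition independent_pair (A B : Type) (X : Omega -> A) (Y : Omega -> B) :
    Prop :=
  forall (E : set A) (F : set B),
    P ((X @^-1` E) `&` (Y @^-1` F)) = (P (X @^-1` E) * P (Y @^-1` F))%E.

Definition uniform_vertex (n : nat) (X : Omega -> 'I_n) : Prop :=
  (forall v, measurable (X @^-1` [set v])) /\
  (forall v, P (X @^-1` [set v]) = ((n%:R : R)^-1)%:E).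

(* [T n] is the tree on n vertices, labelled by order of arrival; [T 0] plays no
   role. [v n] is the vertex of [T n.+1] that the next vertex is attached to.
   The labelled tree [T n.+1] determines [T 1], ..., [T n] and the earlier
   choices, so independence from it is independence from the whole past. *)
Definition uniform_attachment (T : forall n, Omega -> sgraph 'I_n) : Prop :=
  exists v : forall n, Omega -> 'I_n.+1,
    [/\ forall w, T 1 w = edgeless_graph 'I_1,
        forall n, uniform_vertex (v n),
        forall n, independent_pair (T n.+1) (v n) &
        forall n w, T n.+2 w = attach (T n.+1 w) (v n w)].

End Random.

(* Main.v *)
Require Import Defs.
From mathcomp Require Import all_boot all_order all_algebra.
From mathcomp Require Import all_classical all_reals all_analysis.
From mathcomp Require Import zify lra.

(** Write N = n + 1. A uniform attachment tree on N vertices is its parent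
    function, so it is uniform among n! labelled trees, and it is enough to
    count the pairs (f, g) of parent functions for which two induced subtrees
    f[A] and g[B], both missing at most m = N / 1000 vertices, are isomorphic.
    There are too many pairs (A, B) for a trivial bound, but their number is
    only exp(c N) with a small c; what beats it is that a random attachment tree
    hits a prescribed shape with much smaller probability.

    Fix g, A and B with k = #|A| = #|B|, and count the f ([card_embeddable]). An
    isomorphism from f[A] to g[B] enumerates B in the order of arrival in f, and
    each new vertex is attached to an earlier one. Hence, once the first vertex
    r of B is known, the two ends of every edge of g[B] come in a forced order,
    the end nearer to r first ([embeds_root_side]). If g[B] contains M pairwise
    disjoint edges, then exchanging the ends of the edges in any nonempty set of
    these edges breaks a forced order, so at most k * k! / 2^M enumerations are
    possible. Finally f is determined by the enumeration and by its values
    at the remaining vertices, which leaves at most n! k^2 / 2^M functions f.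

    The disjoint edges join an early vertex (one of the first e = n / 2) to a
    child that arrives after the first half. There are #|hit e g| of them up to
    the at most m lost by restricting to B ([matching_in]). For the average of
    2^-#|hit e g| over g, note that it is the probability that a uniformly random
    set S of early vertices misses [hit e g]. For fixed S, each of the n - e late
    vertices avoids S with probability at most 1 - #|S| / n, so all of them do
    with probability at most exp(- #|S| / 2) <= (2 / 3)^#|S|; averaging over S
    gives (5 / 6)^e ([sum_hit_le]).

    The product of (5 / 6)^e with 2^m, k^2 and the number of pairs (A, B) still
    decays exponentially ([union_bound_le]). *)

Set Implicit Arguments.
Unset Strict Implicit.
Unset Printing Implicit Defensive.

Import Order.TTheory GRing.Theory Num.Theory.
Local Open Scope nat_scope.

(** * Trees given by parent functions *)

Section Trees.
Variable n : nat.
Implicit Types (f g : {ffun 'I_n -> 'I_n.+1}) (x y a : 'I_n.+1).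

(** The value [f j] is the parent of vertex [j + 1], which arrives when the
    vertices 0, ..., j are present. *)

Definition increasing f := [forall j, f j <= j].

(** The root 0 is its own parent, so that ancestors are iterates. *)
Definition parent f x := oapp f ord0 (unlift ord0 x).

Definition tree_adj f : rel 'I_n.+1 := fun x y =>
  (x != y) && ((parent f x == y) || (parent f y == x)).

Fact tree_adj_sym f : symmetric (tree_adj f).
Proof. by move=> x y; rewrite /tree_adj eq_sym orbC. Qed.

Fact tree_adj_irrefl f : irreflexive (tree_adj f).
Proof. by move=> x; rewrite /tree_adj eqxx. Qed.

Definition tree f := SGraph (tree_adj_sym f) (tree_adj_irrefl f).

Lemma parent_lift f j : parent f (lift ord0 j) = f j.
Proof. by rewrite /parent liftK. Qed.

Lemma parent0 f : parent f ord0 = ord0.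
Proof. by rewrite /parent unlift_none. Qed.

Lemma parent_lt f x : increasing f -> x != ord0 -> parent f x < x.
Proof.
move=> /forallP incf; case: (unliftP ord0 x) => [j ->|->]; last by rewrite eqxx.
by rewrite parent_lift lift0 ltnS.
Qed.

Lemma parent_le f x : increasing f -> parent f x <= x.
Proof.
move=> incf; have [->|/(parent_lt incf)/ltnW //] := eqVneq x ord0.
by rewrite parent0.
Qed.

Lemma tree_adj_parent f x y :
  increasing f -> tree_adj f x y -> y < x -> parent f x = y.
Proof.
move=> incf /andP[_ /orP[/eqP //|/eqP yx]] lt.
by have := parent_le y incf; rewrite yx leqNgt lt.
Qed.

(** Neighbours determine parents because parents arrive before their children. *)
Lemma tree_inj : {in increasing &, injective tree}.
Proof.
move=> f g incf incg fg; apply/ffunP => j.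
have j0 : lift ord0 j != ord0 by rewrite eq_sym neq_lift.
have lt := parent_lt incf j0.
have : tree g (lift ord0 j) (parent f (lift ord0 j)).
  by rewrite -fg /= /tree_adj eqxx andbT -val_eqE gtn_eqF.
by move=> /(tree_adj_parent incg)/(_ lt); rewrite !parent_lift.
Qed.

Definition branch f a : {set 'I_n.+1} := [set x | fconnect (parent f) x a].

Lemma branch_self f a : a \in branch f a.
Proof. by rewrite inE connect0. Qed.

Lemma branch_parent f a x : parent f x \in branch f a -> x \in branch f a.
Proof. by rewrite !inE; apply: connect_trans; exact: fconnect1. Qed.

Lemma branch_child f a x :
  x \in branch f a -> x != a -> parent f x \in branch f a.
Proof.
rewrite !inE => /iter_findex; case: (findex _ _ _) => [|i] /= <-.
  by rewrite eqxx.
by rewrite -iterS iterSr fconnect_iter.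
Qed.

Lemma branch_ge f a x : increasing f -> x \in branch f a -> a <= x.
Proof.
move=> incf; rewrite inE => /iter_findex <-.
by elim: (findex _ _ _) => //= i; apply: leq_trans; exact: parent_le.
Qed.

(** This is how acyclicity enters: a branch is joined to the rest of the tree by a
    single edge. *)
Lemma exit_branch f a x y :
  x \in branch f a -> y \notin branch f a -> tree_adj f x y ->
  x = a /\ y = parent f x.
Proof.
move=> xa yNa /andP[_ /orP[/eqP yE|/eqP xE]]; last first.
  by move: yNa; rewrite branch_parent ?xE.
split; last by [].
by apply: contraNeq yNa => /(branch_child xa); rewrite yE.
Qed.

(** The subgraph [K] need not be induced. It contains the edge above [x] anyway,
    since otherwise it could not leave the branch of [x]. *)
Lemma subtree_parent f (K : subgraph (tree f)) x z :
  connected_graph (graph_of_subgraph K) -> x \in sub_verts K ->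
  z \in sub_verts K -> z \notin branch f x -> sub_adj K x (parent f x).
Proof.
move=> cK xK zK zNx; apply: contraNT zNx => xpN.
pose D := [pred u : {x | x \in sub_verts K} | val u \in branch f x].
have clD : fingraph.closed (graph_of_subgraph K) D.
  apply: intro_closed; first exact/sym_connect_sym/adj_sym.
  move=> u v uv uD; apply/negP => /negP vND.
  have [Kuv _ _] := sub_adjP uv.
  have [ux vx] := exit_branch uD vND Kuv.
  by move: uv; rewrite /= ux vx ux (negbTE xpN).
have := closed_connect clD (cK (exist _ x xK) (exist _ z zK)).
by rewrite !inE /= connect0 => <-.
Qed.

Lemma subtree_induced f (K : subgraph (tree f)) x y :
  increasing f -> connected_graph (graph_of_subgraph K) ->
  x \in sub_verts K -> y \in sub_verts K -> sub_adj K x y = tree_adj f x y.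
Proof.
move=> incf cK xK yK; apply/idP/idP => [/sub_adjP[]//|].
wlog yE : x y xK yK / parent f x = y.
  move=> W /[dup] xy /andP[_ /orP[]/eqP E]; first exact: W.
  by rewrite sub_adj_sym; apply: W; rewrite // tree_adj_sym.
move=> /andP[xNy _]; rewrite -yE; apply: subtree_parent cK xK yK _.
have x0 : x != ord0.
  by apply: contraNneq xNy => x0; rewrite -yE x0 parent0.
apply/negP => /(branch_ge incf); rewrite leqNgt -yE.
by rewrite parent_lt.
Qed.

(** * Isomorphisms between subtrees and orders of arrival *)

(** [phi] is an isomorphism from [f[A]] to [g[B]] when A and B have the same
    cardinality. The last clause, that every vertex of A except the least one
    has its parent in A, says that [f[A]] is connected. *)
Definition embeds f g (A B : {set 'I_n.+1})
    (phi : {ffun {x | x \in A} -> 'I_n.+1}) :=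
  [&& injectiveb phi, phi \in ffun_on (mem B),
   [forall a, forall b,
     tree_adj f (val a) (val b) == tree_adj g (phi a) (phi b)] &
   [forall a : {x | x \in A}, forall b : {x | x \in A},
     (val b < val a) ==> (parent f (val a) \in A)]].

Definition embeddable f g (A B : {set 'I_n.+1}) :=
  [exists phi : {ffun {x | x \in A} -> 'I_n.+1}, embeds f g B phi].

(** Induction along the path of ancestors from [c], which must end at the least
    vertex of A. *)
Lemma walk_to_root f (A : {set 'I_n.+1}) (r c : {x | x \in A})
    (D : pred {x | x \in A}) :
  increasing f -> (forall u : {x | x \in A}, val r <= val u) ->
  (forall u : {x | x \in A}, val u <= val c -> val u != val r -> D u ->
     exists2 u', val u' = parent f (val u) & D u') ->
  D c -> D r.
Proof.
move=> incf rmin step.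
have [m] := ubnP (val c : nat); elim: m c step => // m IH c step cm Dc.
have [/val_inj <- //|cr] := eqVneq (val c) (val r).
have [u uE Du] := step c (leqnn _) cr Dc.
have c0 : val c != ord0.
  apply: contraNneq cr => c0; apply/eqP/val_inj => /=.
  by apply/eqP; move: (rmin c); rewrite -[sval c]/(val c) c0 leqn0 => /eqP ->.
have uc : val u < val c by rewrite uE parent_lt.
apply: (IH u) => //; last by apply: leq_trans uc _; rewrite -ltnS.
by move=> v vu; apply: step; apply: leq_trans vu (ltnW uc).
Qed.

(** In an embedding, the edge of [g] above [phi a] is traversed from the side of
    the image of the least vertex. Indeed the ancestors in [f] of the end that
    arrives first form a path to [r] that avoids the other end, so its image
    cannot cross that edge, which is the only way in or out of the branch. *)
Lemma embeds_root_side f g (A B : {set 'I_n.+1})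
    (phi : {ffun {x | x \in A} -> 'I_n.+1}) (r a b : {x | x \in A}) :
  increasing f -> embeds f g B phi -> (forall u : {x | x \in A}, val r <= val u) ->
  phi b = parent g (phi a) -> a != b -> phi b \notin branch g (phi a) ->
  (val b < val a) = (phi r \notin branch g (phi a)).
Proof.
move=> incf /and4P[/injectiveP phiI _ /forallP phiE /forallP phiP] rmin bE aNb bN.
have step (u : {x | x \in A}) : val u != val r -> exists u' : {x | x \in A},
    [/\ val u' = parent f (val u), val u' < val u & tree_adj g (phi u) (phi u')].
  move=> ur; have ru : val r < val u.
    by rewrite ltn_neqAle rmin andbT eq_sym; exact: ur.
  have /forallP/(_ r)/implyP/(_ ru) pA := phiP u.
  have lt : parent f (val u) < val u.
    by apply: parent_lt => //; apply: contraTneq ru => ->.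
  pose p : {x | x \in A} := exist (fun x => x \in A) _ pA.
  exists p; split => //.
  have /forallP/(_ p)/eqP <- := phiE u.
  by rewrite /tree_adj /= eqxx andbT eq_sym -val_eqE /= ltn_eqF.
have : tree_adj f (val a) (val b).
  have /forallP/(_ b)/eqP -> := phiE a.
  rewrite /tree_adj -bE eqxx andbT; apply: contraNneq aNb => /phiI ->.
  exact: eqxx.
have [ba _|] := ltnP (val b) (val a).
  apply/esym.
  apply: (@walk_to_root f A r b [pred u | phi u \notin branch g (phi a)]) => //.
  move=> u ub ur uD; have [u' [u'E u'u uu']] := step u ur.
  exists u' => //; apply/negP => u'D.
  have [/phiI u'a _] := exit_branch u'D uD (etrans (tree_adj_sym _ _ _) uu').
  by move: (leq_trans u'u ub); rewrite u'a ltnNge ltnW.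
rewrite leq_eqVlt => /orP[/eqP/val_inj/val_inj E|ab _].
  by move: aNb; rewrite E eqxx.
apply/esym/negbTE; rewrite negbK.
apply: (@walk_to_root f A r a [pred u | phi u \in branch g (phi a)]) => //.
  move=> u ua ur uD; have [u' [u'E u'u uu']] := step u ur.
  exists u' => //; apply/negPn/negP => u'D.
  have [/phiI uE u'E'] := exit_branch uD u'D uu'.
  have /phiI E : phi u' = phi b by rewrite u'E' uE bE.
  by move: (leq_trans u'u ua); rewrite E ltnNge ltnW.
exact: branch_self.
Qed.

End Trees.

(** * Exchanging the ends of disjoint edges *)

Section Swap.
Variables (T : finType) (p : T -> T) (M : {set T}).

(** The pairs {x, p x} with x in M are pairwise disjoint. *)
Definition matching := {in M, forall x, p x \notin M} /\ {in M &, injective p}.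

(** Exchanges x and p x for each x in E. *)
Definition swap (E : {set T}) y :=
  if y \in E then p y else odflt y [pick x in E | p x == y].

Hypothesis matM : matching.
Variable E : {set T}.
Hypothesis subEM : E \subset M.

Lemma swap_in x : x \in E -> swap E x = p x.
Proof. by rewrite /swap => ->. Qed.

Lemma swap_partner x : x \in E -> swap E (p x) = x.
Proof.
move=> xE; have xM := fintype.subsetP subEM _ xE; rewrite /swap.
rewrite (contraNF (fintype.subsetP subEM _) (matM.1 _ xM)).
case: pickP => [y /andP[yE /eqP]|/(_ x)]; last by rewrite xE eqxx.
by apply: matM.2 => //; exact: (fintype.subsetP subEM).
Qed.

Lemma swap_id y : y \notin E -> y \notin p @: E -> swap E y = y.
Proof.
move=> yE ypE; rewrite /swap (negbTE yE); case: pickP => //= x /andP[xE /eqP xy].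
by rewrite -xy imset_f in ypE.
Qed.

Lemma swapK : involutive (swap E).
Proof.
move=> y; have [yE|yE] := boolP (y \in E); first by rewrite (swap_in yE) swap_partner.
have [/imsetP[x xE ->]|ypE] := boolP (y \in p @: E).
  by rewrite (swap_partner xE) swap_in.
by rewrite !(swap_id yE).
Qed.

Lemma swap_out x : x \in M -> x \notin E -> swap E x = x /\ swap E (p x) = p x.
Proof.
move=> xM xE; split; apply: swap_id => //.
- apply/imsetP => -[y yE xy]; have := matM.1 _ (fintype.subsetP subEM _ yE).
  by rewrite -xy xM.
- by apply: contraNN (matM.1 _ xM); exact: (fintype.subsetP subEM).
- apply: contraNN xE => /imsetP[y yE /matM.2 -> //].
  exact: (fintype.subsetP subEM).
Qed.

Lemma swap_stable (B : {set T}) :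
  {in M, forall x, x \in B /\ p x \in B} -> {in B, forall y, swap E y \in B}.
Proof.
move=> MB y yB; have [yE|yE] := boolP (y \in E).
  by rewrite swap_in //; case: (MB y (fintype.subsetP subEM _ yE)).
have [/imsetP[x xE ->]|ypE] := boolP (y \in p @: E); last by rewrite swap_id.
by rewrite swap_partner //; case: (MB x (fintype.subsetP subEM _ xE)).
Qed.

End Swap.

(** * Counting the trees that contain a given subtree *)

Lemma fact_le_prod_succ n (P : pred 'I_n) :
  (\sum_(j < n | P j) 1)`! <= \prod_(j < n | P j) j.+1.
Proof.
elim: n P => [|n IH] P; first by rewrite !big_ord0.
rewrite big_mkcond [X in _ <= X]big_mkcond !big_ord_recr -!big_mkcond /=.
have := IH (fun j => P (widen_ord (leqnSn n) j)).
case: (P ord_max); last by rewrite addn0 muln1.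
rewrite addn1 factS mulnC => IHP; rewrite leq_mul // ltnS.
rewrite -[X in _ <= X]card_ord -sum1_card.
rewrite [X in _ <= X](bigID (fun j => P (widen_ord (leqnSn n) j))) /=.
exact: leq_addr.
Qed.

Lemma card_ord_lt m k : k <= m -> #|[pred i : 'I_m | i < k]| = k.
Proof.
move=> km; have inj : injective (widen_ord km) by move=> i j [/val_inj].
rewrite -[RHS]card_ord -(card_codom inj); apply: eq_card => i.
rewrite !inE; apply/idP/codomP => [ik|[j ->]] /=; last exact: ltn_ord.
by exists (Ordinal ik); exact: val_inj.
Qed.

Section Count.
Variables (n : nat) (g : {ffun 'I_n -> 'I_n.+1}) (A B : {set 'I_n.+1}).
Variables (r : {x | x \in A}) (M : {set 'I_n.+1}).
Hypothesis incg : increasing g.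
Hypothesis cardAB : #|A| = #|B|.
Hypothesis rmin : forall u : {x | x \in A}, val r <= val u.
Hypothesis matM : matching (parent g) M.
Hypothesis MB : {in M, forall x, x \in B /\ parent g x \in B}.

Let late : {set 'I_n} := [set j | (lift ord0 j \in A) && (val r < lift ord0 j)].

Let card_late : #|late| = #|A|.-1.
Proof.
rewrite (cardsD1 (val r) A) (valP r) add1n /= -(card_imset late (@lift_inj _ ord0)).
apply: eq_card => x; rewrite !inE; apply/imsetP/andP => [[j]|[xr xA]].
  by rewrite inE => /andP[jA rj] ->; split=> //; rewrite -val_eqE /= gtn_eqF.
have rx : val r < x.
  by rewrite ltn_neqAle eq_sym xr (rmin (exist (fun x => x \in A) x xA)).
case: (unliftP ord0 x) => [j xE|x0]; last by rewrite x0 in rx.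
by exists j => //; rewrite inE -xE xA.
Qed.

(* An embedding determines [f] on [late], hence only the other values of [f] are
   recorded. *)
Let outer (f : {ffun 'I_n -> 'I_n.+1}) :=
  [ffun j => if j \in late then ord0 else f j].

Let outers := [set h | h \in family (fun j : 'I_n =>
   if j \in late then pred1 (@ord0 n) else [pred i : 'I_n.+1 | i <= j])].

(* The factors j + 1 with j in [late] multiply to at least #|late|!. *)
Let card_outers : #|outers| * (#|A|.-1)`! <= n`!.
Proof.
rewrite cardsE card_family foldrE big_map big_enum /=.
have -> : n`! = \prod_(j < n) j.+1.
  by rewrite fact_prod big_add1 big_mkord.
rewrite (bigID (mem late)) /= [X in _ <= X](bigID (mem late)) /=.
rewrite big1 => [|j ->]; last exact: card1.
rewrite mul1n [X in _ <= X]mulnC; apply: leq_mul; last first.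
  by rewrite -card_late -sum1_card; exact: fact_le_prod_succ.
rewrite (eq_bigr (fun j : 'I_n => j.+1)) // => j /negbTE ->.
by rewrite -[RHS](card_ord_lt (leqW (ltn_ord j))); exact: eq_card.
Qed.

Let emb f := odflt [ffun=> ord0]
  [pick phi | embeds f g B (phi : {ffun {x | x \in A} -> _})].

Let bad := [set f | increasing f & embeddable f g A B].

Let embP f : f \in bad -> increasing f /\ embeds f g B (emb f).
Proof.
rewrite inE => /andP[incf /existsP[phi phiP]]; split=> //; rewrite /emb.
by case: pickP => [//|/(_ phi)]; rewrite phiP.
Qed.

(* The pair (f, E) is encoded injectively by the recorded values of [f], the
   image of the least vertex, and the enumeration of B after exchanging the ends
   of the edges above the vertices of E. *)
Let code (fE : {ffun 'I_n -> 'I_n.+1} * {set 'I_n.+1}) :=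
  (outer fE.1, emb fE.1 r, [ffun a => swap (parent g) fE.2 (emb fE.1 a)]).

Let orders := [set s : {ffun {x | x \in A} -> 'I_n.+1} |
  s \in ffun_on (mem B) & injectiveb s].

Let card_orders : #|orders| = (#|A|)`!.
Proof.
rewrite card_inj_ffuns_on card_sig -ffactnn.
by congr (_ ^_ _); rewrite cardAB; apply: eq_card.
Qed.

Let code_in fE : fE \in finset.setX bad (powerset M) ->
  code fE \in finset.setX (finset.setX outers B) orders.
Proof.
case: fE => f E; rewrite inE /= => /andP[/embP[incf embf]]; rewrite inE => EM.
have /and4P[/injectiveP phiI /ffun_onP phiB _ _] := embf.
rewrite !finset.in_setX /=; apply/andP; split; first (apply/andP; split).
- rewrite inE; apply/familyP => j; rewrite ffunE; case: ifP => _; rewrite inE //.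
  exact: (forallP incf).
- exact: phiB.
- rewrite inE; apply/andP; split.
    by apply/ffun_onP => a; rewrite ffunE; apply: (swap_stable matM EM MB (phiB a)).
  apply/injectiveP => a b; rewrite !ffunE => /(can_inj (swapK matM EM)).
  exact: phiI.
Qed.

Let embeds_child f phi x : embeds f g B phi -> x \in M ->
  exists a b : {x | x \in A}, [/\ phi a = x, phi b = parent g x & a != b].
Proof.
move=> /and4P[/injectiveP phiI /ffun_onP phiB _ _] xM.
have surj y : y \in B -> exists a, phi a = y.
  have -> : y \in B = (y \in codom phi).
    have card_codom_phi : #|codom phi| = #|B|.
      by rewrite card_codom // card_sig -cardAB; exact: eq_card.
    have/(subset_cardP card_codom_phi) -> // : codom phi \subset B.
    by apply/fintype.subsetP => _ /codomP[a ->]; apply: phiB.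
  by case/codomP => a ->; exists a.
have [xB pB] := MB xM; have [[a aE] [b bE]] := (surj _ xB, surj _ pB).
exists a, b; split=> //; apply: contraTneq (xM) => ab.
by rewrite -aE ab bE (matM.1 _ xM).
Qed.

Let parent_notin_branch x : x \in M -> parent g x \notin branch g x.
Proof.
move=> xM; apply/negP => /(branch_ge incg); rewrite leqNgt parent_lt //.
apply: contraTneq (xM) => x0; move: (matM.1 _ xM).
by rewrite x0 parent0.
Qed.

(* If x is in E1 but not in E2, the two embeddings list the ends of the edge above
   x in opposite orders, although they send the least vertex to the same place. *)
Let decode_swaps f1 f2 (E1 E2 : {set 'I_n.+1}) : f1 \in bad -> f2 \in bad ->
  E1 \subset M -> E2 \subset M -> code (f1, E1) = code (f2, E2) ->
  E1 \subset E2.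
Proof.
move=> /embP[inc1 emb1] /embP[inc2 emb2] E1M E2M [_ rE /ffunP codeE].
apply/fintype.subsetP => x xE1; apply: contraTT isT => xE2.
have xM := fintype.subsetP E1M _ xE1.
have [a [b [aE bE aNb]]] := embeds_child emb1 xM.
have [x2 p2] := swap_out matM E2M xM xE2.
have a2E : emb f2 a = parent g x.
  by apply: (can_inj (swapK matM E2M)); have := codeE a;
    rewrite !ffunE /= aE swap_in // p2.
have b2E : emb f2 b = x.
  by apply: (can_inj (swapK matM E2M)); have := codeE b;
    rewrite !ffunE /= bE (swap_partner matM E1M) // x2.
have := embeds_root_side inc1 emb1 rmin (etrans bE (congr1 _ (esym aE))) aNb.
have := embeds_root_side inc2 emb2 rmin (etrans a2E (congr1 _ (esym b2E))).
rewrite aE bE a2E b2E eq_sym aNb parent_notin_branch // -rE.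
move=> /(_ isT isT) <- /(_ isT) ba; case: ltngtP ba => // /val_inj/val_inj E.
by rewrite E eqxx in aNb.
Qed.

(* Once the embeddings agree, the parent of a vertex of A is its only neighbour in
   A that precedes it. *)
Let code_inj : {in finset.setX bad (powerset M) &, injective code}.
Proof.
move=> [f1 E1] [f2 E2]; rewrite !finset.in_setX !powersetE /=.
move=> /andP[f1b E1M] /andP[f2b E2M] codeE.
have E12 : E1 = E2.
  apply/eqP; rewrite finset.eqEsubset (decode_swaps f1b f2b) //.
  exact: (decode_swaps f2b f1b).
subst E2; congr (_, _).
have [inc1 emb1] := embP f1b; have [inc2 emb2] := embP f2b.
have embE : emb f1 = emb f2.
  apply/ffunP => a; case: codeE => _ _ /ffunP/(_ a); rewrite !ffunE.
  exact: (can_inj (swapK matM E1M)).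
have outerE : outer f1 = outer f2 by case: codeE.
apply/ffunP => j; have := congr1 (fun h : {ffun _ -> _} => h j) outerE.
rewrite !ffunE; case: ifP => // jl _.
move: (jl); rewrite inE => /andP[jA rj].
move: emb1 emb2; rewrite embE => /and4P[_ _ /forallP e1 /forallP p1].
move=> /and4P[_ _ /forallP e2 _].
pose a : {x | x \in A} := exist (fun x => x \in A) _ jA.
have /forallP/(_ r)/implyP/(_ rj) pA := p1 a.
pose b : {x | x \in A} := exist (fun x => x \in A) _ pA.
have ba : val b < val a by apply: parent_lt.
have : tree_adj f2 (val a) (val b).
  have /forallP/(_ b)/eqP -> := e2 a; have /forallP/(_ b)/eqP <- := e1 a.
  by rewrite /tree_adj eqxx andbT -val_eqE /= gtn_eqF.
by move=> /(tree_adj_parent inc2)/(_ ba); rewrite /= !parent_lift => ->.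
Qed.

(** Each edge of the matching halves the number of admissible enumerations of B;
    one factor #|A| pays for the image of the least vertex and the other for its
    parent, which is free. *)
Lemma card_embeddable :
  #|[set f | increasing f & embeddable f g A B]| * 2 ^ #|M| <= n`! * #|A| ^ 2.
Proof.
have A0 : 0 < #|A| by rewrite (cardsD1 (val r)) (valP r).
rewrite -/bad; have : #|bad| * 2 ^ #|M| <= #|outers| * #|B| * (#|A|)`!.
  rewrite -card_powerset -cardsX -card_orders -!cardsX -(card_in_imset code_inj).
  apply: subset_leq_card; apply/fintype.subsetP => _ /imsetP[fE fEin ->].
  exact: code_in.
rewrite -cardAB; have := card_outers; move: A0; move: #|A| #|outers| => k m A0 mk le.
have F0 := fact_gt0 k.-1; rewrite -(leq_pmul2r F0).
apply: leq_trans (leq_mul le (leqnn _)) _.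
have -> : k`! = k * k.-1`! by rewrite -{1}(prednK A0) factS prednK.
have -> : m * k * (k * k.-1`!) * k.-1`! = m * k.-1`! * (k ^ 2 * k.-1`!).
  by rewrite -mulnn; lia.
by rewrite -[X in _ <= X]mulnA leq_mul2r mk orbT.
Qed.

End Count.

(** * Disjoint edges between early and late vertices *)

Section Hit.
Variables (n e : nat).
Implicit Types (g : {ffun 'I_n -> 'I_n.+1}) (S : {set 'I_n.+1}).

(** Early vertices (below [e]) with a child that is late (above [e]). *)
Definition hit g := [set v : 'I_n.+1 |
  (v < e) && [exists j : 'I_n, (e <= j) && (g j == v)]].

(** One late child for each vertex of [hit g] gives disjoint edges, since no vertex
    is both early and late; each vertex outside B destroys at most one of them. *)
Lemma matching_in g (B : {set 'I_n.+1}) : exists M,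
  [/\ matching (parent g) M, {in M, forall x, x \in B /\ parent g x \in B} &
      #|hit g| <= #|M| + #|~: B|].
Proof.
pose c v := oapp (lift ord0) v [pick j : 'I_n | (e <= j) && (g j == v)].
have hitP v : v \in hit g -> [/\ v < e, e < c v & parent g (c v) = v].
  rewrite inE => /andP[ve /existsP[j0 j0P]]; rewrite /c.
  case: pickP => [j /andP[ej /eqP gj]|/(_ j0)] /=; last by rewrite j0P.
  by rewrite parent_lift.
pose V := [set v in hit g | (v \in B) && (c v \in B)].
have subV v : v \in V -> v \in hit g by rewrite inE => /andP[].
exists (c @: V); split.
- split=> [_ /imsetP[v /subV/hitP[ve ec pv] ->]|].
    rewrite pv; apply/imsetP => -[w /subV/hitP[_ ew _] vw].
    by move: ve; rewrite vw ltnNge ltnW.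
  move=> _ _ /imsetP[v /subV/hitP[_ _ pv] ->] /imsetP[w /subV/hitP[_ _ pw] ->].
  by rewrite pv pw => ->.
- move=> _ /imsetP[v vV ->]; have [_ _ ->] := hitP v (subV v vV).
  by move: vV; rewrite inE => /and3P[].
rewrite (card_in_imset (f := c)); last first.
  by move=> v w /subV/hitP[_ _ pv] /subV/hitP[_ _ pw] E; rewrite -pv -pw E.
rewrite -(cardsID V (hit g)); apply: leq_add.
  by apply/subset_leq_card/finset.subsetIr.
pose d v := if v \in B then c v else v.
rewrite -[X in X <= _](card_in_imset (f := d)) => [|v w].
  apply/subset_leq_card/fintype.subsetP => _ /imsetP[v vD ->].
  rewrite inE /d; move: vD; rewrite !finset.inE => /andP[] /[swap] -> /=.
  by case: ifP => // ->.
rewrite !finset.in_setD /d => /andP[_ /hitP[ve ev pv]] /andP[_ /hitP[we ew pw]].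
case: ifP => _; case: ifP => _ // E.
- by rewrite -pv -pw E.
- by move: ev; rewrite E ltnNge ltnW.
- by move: ew; rewrite -E ltnNge ltnW.
Qed.

Let early : {set 'I_n.+1} := [set v : 'I_n.+1 | v < e].

Lemma card_avoid S : e <= n -> S \subset early ->
  #|[set g | increasing g & [disjoint S & hit g]]| =
  \prod_(j < n) (if e <= j then j.+1 - #|S| else j.+1).
Proof.
move=> en Se; pose F (j : 'I_n) : pred 'I_n.+1 :=
  [pred i : 'I_n.+1 | (i <= j) && ((e <= j) ==> (i \notin S))].
transitivity #|(family F : simpl_pred {ffun 'I_n -> 'I_n.+1})|.
  rewrite cardsE; apply: eq_card => g; rewrite [LHS]inE.
  apply/andP/familyP => [[/forallP incg dis] j|gF].
    rewrite inE incg; apply/implyP => ej; apply/negP => gS.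
    have := disjointFr dis gS; rewrite inE => /negbT/nandP[]; first by
      move: (fintype.subsetP Se _ gS); rewrite inE => ->.
    by move/existsP; apply; exists j; rewrite ej eqxx.
  split; first by apply/forallP => j; have := gF j; rewrite inE => /andP[].
  rewrite disjoint_sym finset.disjoints_subset; apply/fintype.subsetP => v.
  rewrite !inE => /andP[_ /existsP[j /andP[ej /eqP <-]]].
  by have := gF j; rewrite inE ej => /andP[].
rewrite card_family foldrE big_map big_enum /=; apply: eq_bigr => j _.
have cj := card_ord_lt (leqW (ltn_ord j)).
case: ifP => ej; last by rewrite -[RHS]cj; apply: eq_card => i; rewrite !inE ej andbT.
rewrite -cj -(cardsE [pred i : 'I_n.+1 | i < j.+1]) -cardsDS; last first.
  apply/fintype.subsetP => v /(fintype.subsetP Se); rewrite !inE => ve.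
  by apply: leq_trans (leqnSn _); exact: leq_trans ve ej.
by rewrite -cardsE; apply: eq_card => i; rewrite !inE ej /= andbC.
Qed.

End Hit.

(** * Large common subtrees *)

Section Similar.
Variable n : nat.
Implicit Types (f g : {ffun 'I_n -> 'I_n.+1}) (A B : {set 'I_n.+1}).

Lemma common_subtree_embeddable (W : finType) (S : sgraph W) f g :
  increasing f -> increasing g -> common_subtree S (tree f) (tree g) ->
  exists A B, [/\ #|A| = #|W|, #|B| = #|W| & embeddable f g A B].
Proof.
move=> incf incg [[W0 _ _] [K1 c1 [h1 [k1 h1K k1K] m1]] [K2 c2 [h2 [k2 h2K k2K] m2]]].
exists (sub_verts K1), (sub_verts K2); split.
- by rewrite -card_sig (bij_eq_card (Bijective h1K k1K)).
- by rewrite -card_sig (bij_eq_card (Bijective h2K k2K)).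
apply/existsP; exists [ffun a => val (h2 (k1 a))]; apply/and4P; split.
- by apply/injectiveP => a b; rewrite !ffunE => /val_inj/(can_inj h2K)/(can_inj k1K).
- by apply/ffun_onP => a; rewrite ffunE; exact: valP.
- apply/forallP => a; apply/forallP => b; rewrite !ffunE; apply/eqP.
  rewrite -(subtree_induced incf c1 (valP a) (valP b)).
  rewrite -(subtree_induced incg c2 (valP _) (valP _)).
  have := m1 (k1 a) (k1 b); rewrite !k1K => E1.
  exact: etrans E1 (esym (m2 (k1 a) (k1 b))).
- apply/forallP => a; apply/forallP => b; apply/implyP => ba.
  have bN : val b \notin branch f (val a).
    by apply/negP => /(branch_ge incf); rewrite leqNgt ba.
  by have /sub_adjP[] := subtree_parent c1 (valP a) (valP b) bN.
Qed.

Definition almost_isomorphic m f g :=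
  [exists A : {set 'I_n.+1}, [exists B : {set 'I_n.+1},
  [&& A != finset.set0, #|A| == #|B|, #|~: B| <= m & embeddable f g A B]]].

Lemma large_common_subtree_almost_isomorphic m f g :
  m <= n -> increasing f -> increasing g ->
  n.+1 - m <= largest_common_subtree_size (tree f) (tree g) ->
  almost_isomorphic m f g.
Proof.
move=> mn incf incg; apply: contraTT => notsim.
rewrite -ltnNge (subSn mn) ltnS; apply/bigmax_leqP => k /asboolP[W [S [Wk WS]]].
rewrite leqNgt; apply: contraNN notsim => nk.
have [A [B [Ak Bk emb]]] := common_subtree_embeddable incf incg WS.
apply/existsP; exists A; apply/existsP; exists B; rewrite emb Ak Bk eqxx andbT /=.
move: {k}(nat_of_ord k) Wk nk => k Wk nk.
have := cardsC B; have := card_ord n.+1; rewrite -card_gt0 Ak Bk Wk => -> kE.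
rewrite (leq_ltn_trans (leq0n _) nk) /=; move: #|_| kE => c kE. lia.
Qed.

End Similar.

Lemma card_le_sum (I T : finType) (Q : pred I) (F : I -> {set T}) (X : {set T}) :
  {in X, forall x, exists2 i, Q i & x \in F i} ->
  #|X| <= \sum_(i | Q i) #|F i|.
Proof.
move=> XF; have XU : X \subset (\bigcup_(i | Q i) F i)%SET.
  by apply/fintype.subsetP => x /XF[i Qi xF]; apply/finset.bigcupP; exists i.
apply: leq_trans (subset_leq_card XU) _.
elim/big_rec2: _ => [|i c U _ le]; first by rewrite cards0.
by apply: leq_trans (leq_card_setU _ _) _; rewrite leq_add2l.
Qed.

(** * Averaging over all trees *)

Local Open Scope ring_scope.

Lemma sum_subsets_exp (R : comNzRingType) (T : finType) (E : {set T}) (x : R) :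
  \sum_(S : {set T} | S \subset E) x ^+ #|S| = (1 + x) ^+ #|E|.
Proof.
transitivity (\prod_(i : T) ((if i \in E then x else 0) + 1)); last first.
  rewrite -prodr_const [RHS]big_mkcond; apply: eq_bigr => i _.
  by case: ifP => _; rewrite ?add0r // addrC.
rewrite bigA_distr big_mkcond; apply: eq_bigr => S _.
rewrite -big_mkcond -prodr_const /=; case: ifPn => [/fintype.subsetP SE|].
  by apply: eq_bigr => i /SE ->.
by case/subsetPn => i iS /negbTE iE; rewrite (bigD1 i) //= iE mul0r.
Qed.

(** Weighting each set S by x^(#|S| - m), which is at least 1 when #|S| <= m. *)
Lemma card_small_sets (R : realFieldType) (T : finType) (m : nat) (x : R) :
  0 < x <= 1 ->
  #|[set S : {set T} | (#|S| <= m)%N]|%:R <= (1 + x) ^+ #|T| / x ^+ m.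
Proof.
move=> /andP[x0 x1]; rewrite ler_pdivlMr ?exprn_gt0 //.
rewrite -cardsT -sum_subsets_exp -sum1_card natr_sum mulr_suml.
rewrite [X in _ <= X](bigID (fun S : {set T} => #|S| <= m)%N) /=.
apply: ler_wpDr; first by apply: sumr_ge0 => S _; rewrite exprn_ge0 // ltW.
rewrite (eq_bigl (fun S : {set T} => (S \subset [set: T]%SET) && (#|S| <= m)%N)).
  apply: ler_sum => S /andP[_ Sm]; rewrite mul1r.
  by apply: ler_wiXn2l => //; rewrite ltW.
by move=> S; rewrite finset.inE finset.subsetT.
Qed.

Lemma expRNhalf_le (R : realType) : expR (- 2^-1) <= 2 / 3 :> R.
Proof.
have -> : (2 / 3 : R) = (3 / 2)^-1 by rewrite invf_div.
rewrite expRN lef_pV2 ?posrE ?expR_gt0 //.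
by apply: le_trans (expR_ge1Dx _); lra.
Qed.

(** Late vertex [j + 1] has [j + 1 - #|S|] parents outside S, a proportion at most
    1 - #|S| / n <= exp(- #|S| / n), and at least half of the vertices are late. *)
Lemma card_avoid_le (R : realType) n e (S : {set 'I_n.+1}) :
  (0 < n)%N -> (e.*2 <= n)%N -> S \subset [set v : 'I_n.+1 | (v < e)%N] ->
  #|[set g : {ffun 'I_n -> 'I_n.+1} | increasing g & [disjoint S & hit e g]]|%:R
    <= n`!%:R * (2 / 3) ^+ #|S| :> R.
Proof.
move=> n0 en Se; have en' : (e <= n)%N by apply: leq_trans en; rewrite -addnn leq_addr.
rewrite (card_avoid en' Se) natr_prod.
set s := #|S|.
have se : (s <= e)%N.
  rewrite -(card_ord_lt (leqW en')) -cardsE.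
  exact: subset_leq_card Se.
have n0R : 0 < n%:R :> R by rewrite ltr0n.
pose q : R := expR (- (s%:R / n%:R)).
have q0 : 0 <= q by apply: expR_ge0.
apply: (@le_trans _ _ (\prod_(j < n) (j.+1%:R * (if (e <= j)%N then q else 1)))).
  apply: ler_prod => j _; rewrite ler0n /=; case: ifP => ej; last by rewrite mulr1.
  have sj : (s <= j.+1)%N by apply: leq_trans se (leqW ej).
  rewrite natrB //.
  apply: (@le_trans _ _ (j.+1%:R * (1 - s%:R / n%:R))); last first.
    by rewrite ler_wpM2l // expR_ge1Dx.
  rewrite mulrBr mulr1 lerD2l lerN2 mulrCA ler_piMr // ler_pdivrMr //.
  by rewrite mul1r ler_nat ltn_ord.
rewrite big_split /= -natr_prod.
have -> : (\prod_(j < n) j.+1)%N = n`! by rewrite fact_prod big_add1 big_mkord.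
rewrite ler_wpM2l ?ler0n //.
rewrite -big_mkcond /= -(big_geq_mkord e n xpredT (fun=> q)) prodr_const_nat.
rewrite /q -expRM_natr natrB //.
apply: (@le_trans _ _ (expR (- 2^-1 * s%:R))); last first.
  by rewrite expRM_natr lerXn2r ?nnegrE ?expR_ge0 ?expRNhalf_le.
rewrite ler_expR mulNr mulNr lerN2 mulrC -mulrA ler_wpM2l // ler_pdivlMl //.
have : e.*2%:R <= n%:R :> R by rewrite ler_nat.
rewrite -muln2 natrM; lra.
Qed.

(** After multiplication by 2^e, the left-hand side counts the pairs (g, S) with S
    a set of early vertices disjoint from [hit e g]; sum over g first. *)
Lemma sum_hit_le (R : realType) n e :
  (0 < n)%N -> (e.*2 <= n)%N ->
  \sum_(g : {ffun 'I_n -> 'I_n.+1} | increasing g) (2^-1 : R) ^+ #|hit e g|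
    <= n`!%:R * (5 / 6) ^+ e.
Proof.
move=> n0 en; have en' : (e <= n)%N by apply: leq_trans en; rewrite -addnn leq_addr.
pose early : {set 'I_n.+1} := [set v : 'I_n.+1 | (v < e)%N].
have cE : #|early| = e by rewrite cardsE card_ord_lt ?leqW.
have -> : (5 / 6 : R) = 2^-1 * (1 + 2 / 3) by lra.
rewrite exprMn mulrCA -[X in (1 + 2 / 3) ^+ X]cE -sum_subsets_exp mulr_sumr.
rewrite -ler_pdivrMl; last by rewrite exprn_gt0 ?invr_gt0.
rewrite -exprVn invrK mulr_sumr.
apply: (@le_trans _ _ (\sum_(S : {set 'I_n.+1} | S \subset early)
  #|[set g : {ffun 'I_n -> 'I_n.+1} | increasing g & [disjoint S & hit e g]]|%:R)); last first.
  by apply: ler_sum => S; exact: card_avoid_le.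
under [leRHS]eq_bigr do rewrite -sum1_card natr_sum big_set.
rewrite (exchange_big_dep (fun g : {ffun 'I_n -> 'I_n.+1} => increasing g)) /=; last first.
  by move=> S g _ /andP[].
apply: ler_sum => g incg.
have hE : hit e g \subset early.
  by apply/fintype.subsetP => v; rewrite !inE => /andP[].
rewrite (eq_bigl (fun S => S \in powerset (early :\: hit e g))); last first.
  by move=> S; rewrite powersetE unfold_in incg finset.subsetD.
rewrite -natr_sum sum1_card card_powerset cardsDS // cE natrX.
by rewrite exprVn expfB_cond ?lexx // pnatr_eq0 add0n -[X in (_ <= X)%N]cE subset_leq_card.
Qed.

Section UnionBound.
Variables (R : realType) (n m : nat) (x : R).
Hypothesis n0 : (0 < n)%N.
Hypothesis x01 : 0 < x <= 1.

Let small : {set {set 'I_n.+1}} := [set S : {set 'I_n.+1} | (#|S| <= m)%N].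

Lemma card_embeddable_le (g : {ffun 'I_n -> 'I_n.+1}) (e : nat) (A B : {set 'I_n.+1}) :
  increasing g -> A != finset.set0 -> #|A| = #|B| -> (#|~: B| <= m)%N ->
  #|[set f | increasing f & embeddable f g A B]|%:R
    <= n`!%:R * n.+1%:R ^+ 2 * 2 ^+ m * (2^-1) ^+ #|hit e g| :> R.
Proof.
move=> incg A0 AB Bm; have [M [matM MB hM]] := matching_in e g B.
have [r0 r0A] := finset.set0Pn _ A0.
have [r rA rmin] := arg_minnP (fun x : 'I_n.+1 => val x) r0A.
pose r' : {x | x \in A} := exist (fun x => x \in A) r rA.
have r'min (u : {x | x \in A}) : (val r' <= val u)%N by exact: rmin (valP u).
have := card_embeddable incg AB r'min matM MB.
rewrite -(ler_nat R) !natrM !natrX => le.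
set F := [set f | _]; have le' : #|F|%:R * 2 ^+ #|M| <= n`!%:R * n.+1%:R ^+ 2 :> R.
  apply: le_trans le _; rewrite ler_wpM2l ?ler0n // -expr2 lerXn2r ?nnegrE ?ler0n //.
  by rewrite ler_nat -[leqRHS]card_ord max_card.
rewrite -ler_pdivlMr ?exprn_gt0 // in le'; apply: le_trans le' _.
rewrite -[leRHS]mulrA ler_wpM2l ?mulr_ge0 ?exprn_ge0 ?ler0n //.
rewrite exprVn ler_pdivlMr ?exprn_gt0 // mulrC ler_pdivrMr ?exprn_gt0 // -exprD.
by rewrite ler_weXn2l ?ler1n // addnC; apply: leq_trans hM _; rewrite leq_add2l.
Qed.

Lemma card_almost_isomorphic_le :
  #|[set gf : {ffun 'I_n -> 'I_n.+1} * {ffun 'I_n -> 'I_n.+1} |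
      [&& increasing gf.1, increasing gf.2 & almost_isomorphic m gf.2 gf.1]]|%:R
  <= n`!%:R ^+ 2 * (n.+1%:R ^+ 2 * 2 ^+ m * (5 / 6) ^+ n./2
       * ((1 + x) ^+ n.+1 / x ^+ m) ^+ 2) :> R.
Proof.
pose c : R := n`!%:R * n.+1%:R ^+ 2 * 2 ^+ m.
have c0 : 0 <= c by rewrite !mulr_ge0 ?exprn_ge0 ?ler0n.
have small_le : #|small|%:R <= (1 + x) ^+ n.+1 / x ^+ m.
  by have := card_small_sets 'I_n.+1 m x01; rewrite card_ord.
have half : (n./2.*2 <= n)%N by rewrite -{2}(odd_double_half n) leq_addl.
apply: (@le_trans _ _ (\sum_(g : {ffun 'I_n -> 'I_n.+1} | increasing g)
    (c * 2^-1 ^+ #|hit n./2 g| * #|small|%:R ^+ 2))); last first.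
  rewrite -mulr_suml -mulr_sumr.
  apply: (@le_trans _ _ (c * (n`!%:R * (5 / 6) ^+ n./2) * #|small|%:R ^+ 2)).
    by rewrite ler_wpM2r ?exprn_ge0 ?ler0n // ler_wpM2l // sum_hit_le.
  have -> : n`!%:R ^+ 2 * (n.+1%:R ^+ 2 * 2 ^+ m * (5 / 6) ^+ n./2 *
      ((1 + x) ^+ n.+1 / x ^+ m) ^+ 2)
    = c * (n`!%:R * (5 / 6) ^+ n./2) * ((1 + x) ^+ n.+1 / x ^+ m) ^+ 2 :> R.
    by rewrite /c; lra.
  rewrite ler_wpM2l ?mulr_ge0 ?exprn_ge0 ?ler0n // lerXn2r ?nnegrE ?ler0n //.
  by rewrite (le_trans _ small_le) ?ler0n.
rewrite -sum1_card natr_sum.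
rewrite (eq_bigl (fun gf => increasing gf.1 &&
  (increasing gf.2 && almost_isomorphic m gf.2 gf.1))); last first.
  by move=> gf; rewrite finset.inE.
rewrite -(pair_big_dep (fun g : {ffun 'I_n -> 'I_n.+1} => increasing g)
  (fun g f : {ffun 'I_n -> 'I_n.+1} => increasing f && almost_isomorphic m f g)
  (fun _ _ => 1%:R)) /=.
apply: ler_sum => g incg; rewrite -natr_sum sum1_card.
pose Q (AB : {set 'I_n.+1} * {set 'I_n.+1}) :=
  [&& AB.1 != finset.set0, #|AB.1| == #|AB.2| & (#|~: AB.2| <= m)%N].
pose F (AB : {set 'I_n.+1} * {set 'I_n.+1}) :=
  [set f | increasing f & embeddable f g AB.1 AB.2].
have le : (#|[set f | increasing f & almost_isomorphic m f g]| <= \sum_(AB | Q AB) #|F AB|)%N.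
  apply: card_le_sum => f; rewrite inE => /andP[incf /existsP[A /existsP[B]]].
  case/and4P=> A0 AB Bm emb; exists (A, B); first exact/and3P.
  by rewrite inE incf.
rewrite -cardsE; move: le; rewrite -(ler_nat R) => /le_trans; apply.
rewrite natr_sum; apply: (@le_trans _ _ (\sum_(AB | Q AB) (c * 2^-1 ^+ #|hit n./2 g|))).
  by apply: ler_sum => AB /and3P[A0 /eqP AB' Bm]; exact: card_embeddable_le.
rewrite sumr_const -[leLHS]mulr_natr ler_wpM2l ?mulr_ge0 ?exprn_ge0 ?invr_ge0 //.
rewrite -natrX ler_nat -mulnn -cardsX.
pose compl (AB : {set 'I_n.+1} * {set 'I_n.+1}) := (~: AB.1, ~: AB.2)%SET.
have compl_inj : injective compl.
  by move=> [A B] [A' B'] [/(can_inj (@finset.setCK _)) -> /(can_inj (@finset.setCK _)) ->].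
rewrite -(card_imset _ compl_inj); apply/subset_leq_card/fintype.subsetP.
move=> _ /imsetP[[A B] /and3P[A0 /eqP AB Bm] ->].
rewrite finset.in_setX !inE /= Bm andbT.
by move: Bm; rewrite [X in (X <= _)%N]cardsCs [X in _ -> (X <= _)%N]cardsCs !finset.setCK AB.
Qed.

End UnionBound.

(** * Numerical estimates *)

Section Numerics.
Variable R : realFieldType.

Lemma bernoulli_ineq (t : R) n : 0 <= t -> 1 + n%:R * t <= (1 + t) ^+ n.
Proof.
move=> t0; elim: n => [|n IH]; first by rewrite mul0r addr0 expr0.
rewrite exprS; apply: (@le_trans _ _ ((1 + t) * (1 + n%:R * t))).
  have : 0 <= n%:R * t * t by rewrite !mulr_ge0 ?ler0n.
  rewrite -[n.+1%:R]natr1; lra.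
by rewrite ler_wpM2l // addr_ge0.
Qed.

Lemma linear_mul_expn_le e : e.+1%:R * (97 / 100) ^+ e <= 100 / 3 :> R.
Proof.
have -> : (97 / 100 : R) = (1 + 3 / 97)^-1 by rewrite -[LHS]invf_div; congr (_^-1); lra.
rewrite exprVn ler_pdivrMr; last by rewrite exprn_gt0 //; lra.
have t0 : 0 <= 3 / 97 :> R by lra.
have := bernoulli_ineq e t0; have : 0 <= e%:R :> R by rewrite ler0n.
rewrite -[e.+1%:R]natr1; lra.
Qed.

(** The cost 2 * 100^2 of each of the N / 1000 missing vertices, spread over 1000
    vertices. *)
Lemma deletion_cost_le : 2 * (1 / 100)^-1 ^+ 2 <= (51 / 50) ^+ 1000 :> R.
Proof.
have two : 2 <= (51 / 50) ^+ 50 :> R.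
  have t0 : 0 <= 1 / 50 :> R by lra.
  by have := bernoulli_ineq 50 t0; rewrite (_ : 1 + 1 / 50 = 51 / 50 :> R); lra.
rewrite (exprM _ 50 20); move: (_ ^+ 50) two => t two.
apply: (@le_trans _ _ (2 ^+ 20)); last by apply: lerXn2r; rewrite ?nnegrE //; lra.
(* 2^5 * 1024 already exceeds 20000. *)
rewrite -[20%N]/(15 + 5)%N exprD; have : 1024 <= 2 ^+ 15 :> R by lra.
lra.
Qed.

(** The left-hand side is the union bound with x = 1 / 100 and m = N / 1000. The
    subsets contribute q^N with q = 51/50 * (1 + 1/100)^2, and the decay wins
    because q^2 * 5/6 <= (97/100)^3. Two of these three factors (97/100)^e absorb
    N^2, and the third one remains. *)
Lemma union_bound_le n :
  n.+1%:R ^+ 2 * 2 ^+ (n.+1 %/ 1000) * (5 / 6) ^+ n./2 *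
    ((1 + 1 / 100) ^+ n.+1 / (1 / 100) ^+ (n.+1 %/ 1000)) ^+ 2
  <= 100 ^+ 2 * (99 / 100) ^+ n.+1 :> R.
Proof.
set e := n./2; set m := (n.+1 %/ 1000)%N.
have ne : (n.+1 <= e.+1.*2)%N by rewrite /e; lia.
have mN : (1000 * m <= n.+1)%N by rewrite /m; lia.
have deletions : 2 ^+ m * ((1 / 100)^-1 ^+ m) ^+ 2 <= (51 / 50) ^+ n.+1 :> R.
  rewrite -exprM mulnC exprM -exprMn.
  apply: (@le_trans _ _ ((51 / 50) ^+ (1000 * m))).
    rewrite (exprM _ 1000 m).
    have : 0 <= 2 * (1 / 100)^-1 ^+ 2 :> R by lra.
    have := deletion_cost_le; move: (_ ^+ 1000) (2 * _) => t c ct c0.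
    by apply: lerXn2r; rewrite // nnegrE (le_trans c0).
  by rewrite ler_weXn2l //; lra.
pose q : R := 51 / 50 * (1 + 1 / 100) ^+ 2.
have q1 : 1 <= q by rewrite /q; lra.
have q0 : 0 <= q := le_trans ler01 q1.
have qe : q ^+ n.+1 * (5 / 6) ^+ e <= 11 / 10 * ((97 / 100) ^+ e) ^+ 3.
  apply: (@le_trans _ _ (q ^+ e.+1.*2 * (5 / 6) ^+ e)).
    by rewrite ler_wpM2r ?exprn_ge0 // ler_weXn2l.
  rewrite -muln2 mulnC exprM exprS -mulrA -exprMn -exprM [(e * 3)%N]mulnC exprM.
  have q2 : q ^+ 2 * (5 / 6) <= (97 / 100) ^+ 3 by rewrite /q; lra.
  have q2' : q ^+ 2 <= 11 / 10 by rewrite /q; lra.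
  have q20 : 0 <= q ^+ 2 by rewrite exprn_ge0.
  apply: ler_pM; rewrite ?exprn_ge0 ?mulr_ge0 //.
  by apply: lerXn2r; rewrite ?nnegrE ?exprn_ge0 ?mulr_ge0.
have e97 : (97 / 100) ^+ e <= 11 / 10 * (99 / 100) ^+ n.+1 :> R.
  apply: (@le_trans _ _ (11 / 10 * (99 / 100) ^+ e.+1.*2)); last first.
    by rewrite ler_wpM2l // ler_wiXn2l //; lra.
  rewrite -muln2 mulnC exprM exprS mulrA.
  apply: (@le_trans _ _ (1 * ((99 / 100) ^+ 2) ^+ e)).
    by rewrite mul1r lerXn2r ?nnegrE ?exprn_ge0 //; lra.
  by rewrite ler_wpM2r ?exprn_ge0 //; lra.
have ne2 : n.+1%:R <= 2 * e.+1%:R :> R by rewrite -natrM ler_nat mul2n.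
set y := (97 / 100) ^+ e in qe e97 *.
have y0 : 0 <= y by rewrite exprn_ge0.
have ey : e.+1%:R * y <= 100 / 3 by exact: linear_mul_expn_le.
set N : R := n.+1%:R in ne2 *; set E : R := e.+1%:R in ne2 ey.
have N0 : 0 <= N by rewrite ler0n.
have E0 : 0 <= E by rewrite ler0n.
apply: (@le_trans _ _ (N ^+ 2 * (q ^+ n.+1 * (5 / 6) ^+ e))).
  rewrite -mulrA -mulrA ler_wpM2l ?exprn_ge0 //.
  have -> : ((1 + 1 / 100) ^+ n.+1 / (1 / 100) ^+ m) ^+ 2
    = ((1 + 1 / 100) ^+ 2) ^+ n.+1 * ((1 / 100)^-1 ^+ m) ^+ 2 :> R.
    by rewrite -exprVn exprMn exprAC.
  have : 0 <= ((1 + 1 / 100) ^+ 2) ^+ n.+1 * (5 / 6) ^+ e :> R.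
    by rewrite mulr_ge0 ?exprn_ge0.
  have -> : q ^+ n.+1 = (51 / 50) ^+ n.+1 * ((1 + 1 / 100) ^+ 2) ^+ n.+1.
    exact: exprMn.
  move: deletions; set a := (51 / 50) ^+ n.+1.
  set b := ((1 + 1 / 100) ^+ 2) ^+ n.+1; set z := ((1 / 100)^-1 ^+ m) ^+ 2.
  move: a b z (2 ^+ m) ((5 / 6) ^+ e) => a b z c d cz bd.
  have -> : c * (d * (b * z)) = c * z * (b * d) by lra.
  by rewrite -[X in _ <= X]mulrA ler_wpM2r.
apply: (@le_trans _ _ ((2 * E) ^+ 2 * (11 / 10 * y ^+ 3))).
  by rewrite ler_pM ?mulr_ge0 ?exprn_ge0 // lerXn2r ?nnegrE ?mulr_ge0.
have -> : (2 * E) ^+ 2 * (11 / 10 * y ^+ 3) = 44 / 10 * (E * y) ^+ 2 * y by lra.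
have Ey2 : (E * y) ^+ 2 <= (100 / 3) ^+ 2 by rewrite lerXn2r ?nnegrE ?mulr_ge0.
apply: (@le_trans _ _ (44 / 10 * (100 / 3) ^+ 2 * y)).
  by rewrite ler_wpM2r // ler_wpM2l.
have : 0 <= (99 / 100) ^+ n.+1 :> R by rewrite exprn_ge0.
lra.
Qed.

End Numerics.

(** * The law of a uniform attachment tree *)

Lemma sgraph_ext (V : finType) (G H : sgraph V) : G =2 H -> G = H.
Proof.
case: G => a sa ia; case: H => b sb ib /= ab.
have E : a = b by apply/funext => x; apply/funext => y; exact: ab.
by case: _ / E in sb ib ab *; congr SGraph; exact: Prop_irrelevance.
Qed.

Section Recorded.
Variable u : nat -> nat.
Hypothesis u_le : forall j, (u j <= j)%N.

Definition recorded n : {ffun 'I_n -> 'I_n.+1} := [ffun j : 'I_n => inord (u j)].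

Lemma val_recorded n (j : 'I_n) : recorded n j = u j :> nat.
Proof. by rewrite ffunE inordK // ltnS (leq_trans (u_le j)) // ltnW. Qed.

Lemma recorded_increasing n : increasing (recorded n).
Proof. by apply/forallP => j; rewrite val_recorded. Qed.

Definition previous x := if x is j.+1 then u j else 0%N.

Lemma previous_le x : (previous x <= x)%N.
Proof. by case: x => //= j; exact: leqW. Qed.

Lemma val_parent_recorded n (x : 'I_n.+1) :
  parent (recorded n) x = previous x :> nat.
Proof.
case: (unliftP ord0 x) => [j ->|->]; last by rewrite parent0.
by rewrite parent_lift val_recorded.
Qed.

(** Attaching a vertex appends one value to the parent function. *)
Lemma attach_recorded n (v : 'I_n.+1) : v = u n :> nat ->
  attach (tree (recorded n)) v = tree (recorded n.+1).
Proof.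
move=> vE; apply: sgraph_ext => x y.
have ordE m (i j : 'I_m) : (i == j) = (i == j :> nat) by [].
have adjE m (i j : 'I_m.+1) : tree_adj (recorded m) i j =
    (i != j :> nat) && ((previous i == j) || (previous j == i)).
  by rewrite /tree_adj !ordE !val_parent_recorded.
rewrite [RHS]adjE /= /attach_adj.
case: (unliftP ord_max x) => [i ->|->]; case: (unliftP ord_max y) => [j ->|->];
  rewrite ?lift_max.
- exact: adjE.
- rewrite ordE vE /= (ltn_eqF (ltn_ord i)).
  by rewrite (ltn_eqF (leq_ltn_trans (previous_le i) (ltn_ord i))) eq_sym.
- rewrite ordE vE /= (gtn_eqF (ltn_ord j)) orbC.
  by rewrite (ltn_eqF (leq_ltn_trans (previous_le j) (ltn_ord j))) eq_sym.
- by rewrite eqxx.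
Qed.

End Recorded.

Local Open Scope classical_set_scope.
Local Open Scope ring_scope.

Section Law.
Context (R : realType) (d : measure_display) (Omega : measurableType d).
Variable P : probability Omega R.

(** The tree determines the earlier choices ([tree_inj]), so that prescribing the
    tree on n + 2 vertices amounts to prescribing the tree on n + 1 vertices and
    one more choice, which is independent of it. *)
Lemma law_of_choices (T : forall n, Omega -> sgraph 'I_n)
    (v : forall n, Omega -> 'I_n.+1) (u : nat -> nat) n :
  (forall j, u j <= j)%N ->
  (forall n w, T n.+1 w = tree (recorded (fun j => v j w) n)) ->
  (forall n, uniform_vertex P (v n)) ->
  (forall n, independent_pair P (T n.+1) (v n)) ->
  measurable (T n.+1 @^-1` [set tree (recorded u n)]) /\
  P (T n.+1 @^-1` [set tree (recorded u n)]) = ((n`!%:R : R)^-1)%:E.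
Proof.
move=> ule TE unif indep.
have vle w j : (v j w <= j)%N by rewrite -ltnS ltn_ord.
elim: n => [|n [mIH PIH]].
  rewrite (_ : _ @^-1` _ = setT).
    by split; [exact: measurableT | rewrite probability_setT invr1].
  rewrite -subTset => w _ /=; rewrite TE; congr tree.
  by apply/ffunP => -[].
pose vn : 'I_n.+1 := inord (u n).
have vnE : vn = u n :> nat by rewrite inordK // ltnS.
have -> : T n.+2 @^-1` [set tree (recorded u n.+1)] =
    (T n.+1 @^-1` [set tree (recorded u n)]) `&` (v n @^-1` [set vn]).
  apply/seteqP; split=> w /=; rewrite !TE.
    move=> /(tree_inj (recorded_increasing (vle w) _) (recorded_increasing ule _)) E.
    have vu (j : 'I_n.+1) : v j w = u j :> nat.
      by rewrite -(val_recorded (vle w)) E val_recorded.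
    split; last by apply: val_inj; exact: etrans (vu ord_max) (esym vnE).
    congr tree; apply/ffunP => j; rewrite !ffunE; congr inord.
    exact: (vu (widen_ord (leqnSn n) j)).
  case=> E vE; rewrite -(attach_recorded (vle w) (erefl (v n w : nat))) E.
  by rewrite vE (attach_recorded ule vnE).
have [mv Pv] := unif n; split; first exact: measurableI.
rewrite indep PIH Pv -EFinM; congr (_%:E).
by rewrite -invfM factS natrM mulrC.
Qed.

Lemma uniform_attachment_law (T : forall n, Omega -> sgraph 'I_n) :
  uniform_attachment P T -> forall n,
  (forall w, exists2 f, increasing f & T n.+1 w = tree f) /\
  (forall f, increasing f -> measurable (T n.+1 @^-1` [set tree f]) /\
     P (T n.+1 @^-1` [set tree f]) = ((n`!%:R : R)^-1)%:E).
Proof.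
move=> [v [T1 unif indep TS]] n.
have vle w j : (v j w <= j)%N by rewrite -ltnS ltn_ord.
have TE m w : T m.+1 w = tree (recorded (fun j => v j w) m).
  elim: m => [|m IH].
    rewrite T1; apply: sgraph_ext => x y.
    by rewrite /= /tree_adj !ord1 eqxx.
  by rewrite TS IH; exact: (attach_recorded (vle w)).
split=> [w|f incf].
  by exists (recorded (fun j => v j w) n) => //; exact: recorded_increasing.
pose u j := if insub j is Some i then f i : nat else 0%N.
have ule j : (u j <= j)%N.
  by rewrite /u; case: insubP => // i _ <-; exact: (forallP incf).
have -> : f = recorded u n.
  by apply/ffunP => j; rewrite ffunE /u valK inord_val.
exact: law_of_choices.
Qed.

Lemma bigcup_finite_le (I : finType) (Q : pred I) (F : I -> set Omega) (c : R) :
  (forall i, Q i -> measurable (F i) /\ P (F i) = c%:E) ->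
  measurable (\bigcup_(i in [set` Q]) F i) /\
  (P (\bigcup_(i in [set` Q]) F i) <= (#|[set i | Q i]%SET|%:R * c)%:E)%E.
Proof.
move=> QF; rewrite bigcup_pred -sum1_card natr_sum mulr_suml.
have -> : \sum_(i in [set i | Q i]%SET) 1 * c = \sum_(i in Q) 1 * c.
  by apply: eq_bigl => i; rewrite finset.inE.
elim/big_rec2: _ => [|i s U Qi [mU PU]]; first by rewrite measure0.
have [mF PF] := QF i Qi; split; first exact: measurableU.
apply: le_trans (measureU2 _ mF mU) _.
by rewrite EFinD leeD // mul1r -PF; exact: lexx.
Qed.

End Law.

(** * The probability of a large common subtree *)

(** The upper bound 1 is part of the statement because it rests on the measurability
    of the event, which comes from its description as a finite union. *)
Lemma no_large_common_subtree_prob (R : realType) (d : measure_display)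
    (Omega : measurableType d) (P : probability Omega R)
    (T1 T2 : forall n : nat, Omega -> sgraph 'I_n) n :
  uniform_attachment P T1 -> uniform_attachment P T2 ->
  independent_pair P (T1 n.+1) (T2 n.+1) -> (0 < n)%N ->
  ((1 - 100 ^+ 2 * (99 / 100) ^+ n.+1)%:E <= P [set w : Omega |
      (largest_common_subtree_size (T1 n.+1 w) (T2 n.+1 w))%:R
        <= 999 / 1000 * n.+1%:R :> R]%R <= 1)%E.
Proof.
move=> /uniform_attachment_law/(_ n)[cover1 law1].
move=> /uniform_attachment_law/(_ n)[cover2 law2] indep n0.
set good := [set w | _]; set m := (n.+1 %/ 1000)%N.
pose code := {ffun 'I_n -> 'I_n.+1}.
pose F (gf : code * code) :=
  (T1 n.+1 @^-1` [set tree gf.2]) `&` (T2 n.+1 @^-1` [set tree gf.1]).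
pose c : R := n`!%:R^-1 * n`!%:R^-1.
pose fits (gf : code * code) :=
  (largest_common_subtree_size (tree gf.2) (tree gf.1))%:R <= 999 / 1000 * n.+1%:R :> R.
pose Q gf := [&& increasing gf.1, increasing gf.2 & ~~ fits gf].
have FP (gf : code * code) : Q gf -> measurable (F gf) /\ P (F gf) = c%:E.
  move=> /and3P[incg incf _].
  have [m1 P1] := law1 _ incf; have [m2 P2] := law2 _ incg.
  by split; [exact: measurableI | rewrite indep P1 P2 -EFinM].
have [mbad Pbad] := bigcup_finite_le FP.
have -> : good = ~` (\bigcup_(gf in [set` Q]) F gf).
  apply/seteqP; split=> w.
    by move=> goodw [[g f] /and3P[_ _ /negP Nfits] [/= wf wg]]; apply: Nfits;
      rewrite /fits /= -wf -wg.
  move=> Nbad; apply: contrapT => Ngood; apply: Nbad.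
  have [f incf wf] := cover1 w; have [g incg wg] := cover2 w.
  exists (g, f); last by split.
  by apply/and3P; split=> //; apply/negP; rewrite /fits /= -wf -wg.
apply/andP; split; last by apply: probability_le1; exact: measurableC.
rewrite probability_setC // EFinB leeB //; apply: le_trans Pbad _.
have n01 : 0 < n`!%:R :> R by rewrite ltr0n fact_gt0.
rewrite lee_fin /c -invfM ler_pdivrMr ?mulr_gt0 // mulrC -expr2.
apply: (@le_trans _ _ (n`!%:R ^+ 2 * (n.+1%:R ^+ 2 * 2 ^+ m * (5 / 6) ^+ n./2 *
    ((1 + 1 / 100) ^+ n.+1 / (1 / 100) ^+ m) ^+ 2))); last first.
  by rewrite ler_wpM2l ?exprn_ge0 ?ler0n // union_bound_le.
have x01 : 0 < (1 / 100 : R) <= 1 by apply/andP; split; lra.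
apply: le_trans (@card_almost_isomorphic_le R n m (1 / 100) n0 x01).
rewrite ler_nat; apply/subset_leq_card/fintype.subsetP => gf.
rewrite !finset.inE => /and3P[incg incf]; rewrite incg incf /fits -ltNge => big.
apply: large_common_subtree_almost_isomorphic => //; first by rewrite /m; lia.
move: big; set X := largest_common_subtree_size _ _ => big.
have : (999 * n.+1 < 1000 * X)%N by rewrite -(ltr_nat R) !natrM; lra.
rewrite /m; lia.
Qed.

Theorem theorem1p2 (R : realType) (d : measure_display)
    (Omega : measurableType d) (P : probability Omega R)
    (T1 T2 : forall n : nat, Omega -> sgraph 'I_n)
    (hT1 : uniform_attachment P T1) (hT2 : uniform_attachment P T2)
    (hT12 : forall n : nat, independent_pair P (T1 n) (T2 n)) :
  (fun n : nat => P [set w : Omega |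
      (largest_common_subtree_size (T1 n w) (T2 n w))%:R
        <= 999 / 1000 * n%:R :> R]) @ \oo --> 1%E.
Proof.
have bound : (fun n => (1 - 100 ^+ 2 * (99 / 100) ^+ n : R)%:E) @ \oo --> 1%E.
  apply: cvg_EFin; first by near=> n.
  rewrite -[X in _ --> X](_ : 1 - 100 ^+ 2 * 0 = 1 :> R); last by rewrite mulr0 subr0.
  apply: cvgB; first exact: cvg_cst.
  by apply: cvgMr; apply: cvg_expr; rewrite ger0_norm; lra.
apply: squeeze_cvge bound (cvg_cst _).
near=> n; have n1 : (1 < n)%N by near: n; exact: nbhs_infty_gt.
rewrite -(prednK (ltnW n1)); apply: no_large_common_subtree_prob => //.
by rewrite -ltnS (prednK (ltnW n1)).
Unshelve. all: by end_near.
Qed.
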